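(* The traffic shaping game defined in the context has a Nash equilibrium; that is, there is a strategy profile $\boldsymbol y^*=(\boldsymbol y^{v,*}:v\in\mathcal V)$, $\boldsymbol y^{v,*}=(\tilde{\boldsymbol\rho}^{v,*},x_v^* )$, such that for every $v\in\mathcal V$, $\boldsymbol y^{v,*}\in Y^v(\boldsymbol y^{-v,*})$ and $$x_v^*\le x_v\quad\text{for all }\boldsymbol y^v=(\tilde{\boldsymbol\rho}^v,x_v)\in Y^v(\boldsymbol y^{-v,*}).$$
   Context: $\mathcal B$ (base stations, $|\mathcal B|=B$) and $\mathcal V$ (slices, the players) are finite nonempty sets. Each slice $v$ has a share $s^v>0$ with $\sum_v s^v=1$; a normalized mean-delay requirement $\tilde d_v>1$; arrival rates $\boldsymbol\gamma^v=(\gamma_b^v)_b$ with $\gamma_b^v>0$; mean sojourn times $\boldsymbol\mu^v=(\mu_b^v)_b$ with $\mu_b^v>0$; and a substochastic routing matrix $\boldsymbol Q^v=(q_{i,j}^v)_{i,j\in\mathcal B}$ such that customers eventually leave the network (so $\boldsymbol I-(\boldsymbol Q^v)^T$ is invertible with inverse $\sum_{k\ge0}((\boldsymbol Q^v)^T)^k$). Put $$\boldsymbol M^v=\mathrm{diag}(\boldsymbol\gamma^v)^{-1}(\boldsymbol I-(\boldsymbol Q^v)^T)\,\mathrm{diag}(\boldsymbol\mu^v)^{-1}.$$ Game. A strategy of slice $v$ is $\boldsymbol y^v=(\tilde{\boldsymbol\rho}^v,x_v)$ with $\tilde{\boldsymbol\rho}^v\in\mathbb R^{\mathcal B}$ (relative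 load distribution) and $x_v\in\mathbb R$ (reciprocal $1/\rho^v$ of its overall carried load). Given the others' strategies $\boldsymbol y^{-v}=(\boldsymbol y^{w})_{w\ne v}$, the feasible set of slice $v$ is $$Y^v(\boldsymbol y^{-v})=\Big\{\boldsymbol y^v:\ \langle\mathbf 1,\tilde{\boldsymbol\rho}^v\rangle=1,\ \ \boldsymbol 0\preceq\boldsymbol M^v\tilde{\boldsymbol\rho}^v\preceq x_v\mathbf 1,\ \ f_v(\tilde{\boldsymbol\rho}^v;\tilde{\boldsymbol\rho}^{-v})\le s^v(\tilde d_v-1)x_v\Big\},$$ where $f_v(\tilde{\boldsymbol\rho}^v;\tilde{\boldsymbol\rho}^{-v})=\langle\tilde{\boldsymbol g},\tilde{\boldsymbol\rho}^v\rangle$ with $\tilde{\boldsymbol g}=\sum_{w\in\mathcal V}s^w\tilde{\boldsymbol\rho}^w$ (including the term $w=v$), and $\preceq$ is componentwise. Slice $v$ seeks to minimize $\theta_v(\boldsymbol y^v,\boldsymbol y^{-v})=x_v$ over $Y^v(\boldsymbol y^{-v})$. *)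

(* Defs.v *)
From HB Require Import structures.
From mathcomp Require Import all_boot all_order all_algebra.
From mathcomp Require Import all_classical all_reals all_analysis.

Set Implicit Arguments.
Unset Strict Implicit.
Unset Printing Implicit Defensive.

Import Order.TTheory GRing.Theory Num.Theory.
Import numFieldNormedType.Exports.
Local Open Scope classical_set_scope.
Local Open Scope ring_scope.

(* The base stations are the elements of 'I_nB; the slices are the elements of
   a finite type V. *)

Definition inner (R : realType) (nB : nat) (a c : 'cV[R]_nB) : R :=
  \sum_(b < nB) a b 0 * c b 0.

Definition substochastic (R : realType) (nB : nat) (Q : 'M[R]_nB) : Prop :=
  (forall i j, 0 <= Q i j) /\ (forall i, \sum_(j < nB) Q i j <= 1).

(* [\sum_j (Q ^+ k) i j] is the probability that a customer who starts at
   station [i] is still in the network after [k] routing steps. *)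
Definition eventually_leave (R : realType) (nB : nat) (Q : 'M[R]_nB) : Prop :=
  forall i, (fun k : nat => \sum_(j < nB) (Q ^+ k) i j) @ \oo --> (0 : R).

Definition traffic_mx (R : realType) (nB : nat)
    (gamma mu : 'rV[R]_nB) (Q : 'M[R]_nB) : 'M[R]_nB :=
  invmx (diag_mx gamma) *m (1%:M - Q^T) *m invmx (diag_mx mu).

(* A strategy is a pair (rho, x) : the relative load distribution and the
   reciprocal of the overall carried load. *)
Definition strategy (R : realType) (nB : nat) : Type := ('cV[R]_nB * R)%type.

Section Game.
Variables (R : realType) (nB : nat) (V : finType).
Variables (s d : V -> R) (gamma mu : V -> 'rV[R]_nB) (Q : V -> 'M[R]_nB).

(* The profile in which [v] plays [yv] and every other slice [w] plays [y w]. *)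
Definition deviate (y : V -> strategy R nB) (v : V) (yv : strategy R nB) :
    V -> strategy R nB :=
  fun w => if w == v then yv else y w.

Definition aggregate_load (y : V -> strategy R nB) : 'cV[R]_nB :=
  \sum_(w : V) s w *: (y w).1.

Definition coupling (v : V) (y : V -> strategy R nB) : R :=
  inner (aggregate_load y) (y v).1.

(* Only the components [y w] with [w != v] matter: [deviate] discards [y v]. *)
Definition feasible (v : V) (y : V -> strategy R nB) : set (strategy R nB) :=
  [set yv : strategy R nB |
    [/\ inner (const_mx 1) yv.1 = 1,
        forall b, 0 <= (traffic_mx (gamma v) (mu v) (Q v) *m yv.1) b 0 <= yv.2
      & coupling v (deviate y v yv) <= s v * (d v - 1) * yv.2]].

Definition cost (v : V) (y : V -> strategy R nB) : R := (y v).2.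

Definition nash_equilibrium (y : V -> strategy R nB) : Prop :=
  forall v, feasible v y (y v) /\
    forall yv, feasible v y yv -> cost v y <= cost v (deviate y v yv).

End Game.

(* Main.v *)
(* The smallest x_v compatible with a load vector rho is the maximum of 0, of
   the coordinates of M^v rho, and of f_v / (s^v (d_v - 1)).  It is convex in
   rho and jointly continuous, and the admissible rho form a nonempty compact
   convex set: since the powers of Q^v tend to 0, M^v rho >= 0 forces rho >= 0.
   So the game is an ordinary convex game, and its equilibria are the solutions
   x of Ky Fan's inequality 0 <= phi(x, y) for all y, where phi(x, y) sums over
   the slices the cost increase of deviating unilaterally from x to y.  Ky Fan's
   inequality follows, through the finite intersection property, from a
   Knaster-Kuratowski-Mazurkiewicz covering theorem on a simplex.  That theorem
   is obtained by applying to finer and finer grids Scarf's combinatorial lemma,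
   a parity argument about finite sets with several linear orders, which needs
   no triangulation. *)
Require Import Defs.
From mathcomp Require Import all_boot zify.

Set Implicit Arguments.
Unset Strict Implicit.
Unset Printing Implicit Defensive.

(** * Scarf's lemma *)

Section Scarf.
Variables (Z I : finType) (R : I -> Z -> nat).
Hypothesis R_inj : forall i, injective (R i).
Implicit Types (S : {set Z}).

(** For nonempty [S]: no point lies strictly above the minimum of [S] in every order at once. With
    [#|S| = #|I|] these are Scarf's primitive sets. *)
Definition dominant S :=
  [forall y, exists i, forall x in S, R i y <= R i x].

Lemma dominantP S :
  reflect (forall y, exists i, forall x, x \in S -> R i y <= R i x) (dominant S).
Proof.
apply: (iffP forallP) => domS y.
  by have /existsP[i /forall_inP iP] := domS y; exists i.
by have [i iP] := domS y; apply/existsP; exists i; apply/forall_inP.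
Qed.

Definition lowest S i x := (x \in S) && [forall z in S, R i x <= R i z].

Lemma lowestP S i x :
  reflect (x \in S /\ forall z, z \in S -> R i x <= R i z) (lowest S i x).
Proof. by apply: (iffP andP) => -[xS /forall_inP]. Qed.

Lemma ex_lowest S i : S != set0 -> exists x, lowest S i x.
Proof.
case/set0Pn => x0 x0S.
case: (arg_minnP (R i) x0S) => x xS xmin.
by exists x; apply/lowestP.
Qed.

Lemma lowest_inj S i x y : lowest S i x -> lowest S i y -> x = y.
Proof.
case/lowestP=> xS xm /lowestP[yS ym]; apply: (R_inj (i := i)).
by apply/eqP; rewrite eqn_leq xm ?ym.
Qed.

Lemma dominant_lowest S x : dominant S -> x \in S -> exists i, lowest S i x.
Proof.
by move=> /dominantP/(_ x)[i iP] xS; exists i; apply/lowestP.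
Qed.

(** By dominance at its own points, each element of [S] is a minimum in some order, so the minima
    exhaust [S]. *)
Lemma lowest_image S (m : I -> Z) :
  dominant S -> (forall k, lowest S k (m k)) -> m @: I = S.
Proof.
move=> domS mP; apply/setP => x; apply/imsetP/idP => [[k _ ->]|xS].
  by case/lowestP: (mP k).
have [k lk] := dominant_lowest domS xS; exists k => //.
exact: lowest_inj lk (mP k).
Qed.

(** When [m] lists the minima of [S], adding one of these points to [S] leaves every minimum in
    place except possibly that of order [i]. *)
Definition above (m : I -> Z) i : {set Z} :=
  [set y | [forall k, (k != i) ==> (R k (m k) < R k y)]].

Lemma aboveP (m : I -> Z) i y :
  reflect (forall k, k != i -> R k (m k) < R k y) (y \in above m i).
Proof. by rewrite inE; apply: (iffP forall_inP). Qed.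

(** Order [j] keeps [m i] as a minimum, so order [i] is free to take [z] instead. A point of
    [above m i] is at most [z] in order [i] by maximality, and any other point is already blocked by
    some [m k] with [k != i]. *)
Lemma dominant_setU1 S (m : I -> Z) i j :
    (forall k, lowest S k (m k)) -> dominant S -> i != j -> m i = m j ->
  forall z, z \in above m i -> (forall y, y \in above m i -> R i y <= R i z) ->
  z \notin S /\ dominant (z |: S).
Proof.
move=> mP domS ij mij z /aboveP zG zmax.
have mlow k x : x \in S -> R k (m k) <= R k x by have /lowestP[_] := mP k; apply.
split.
  apply/negP => zS; have [k lk] := dominant_lowest domS zS.
  have zk : z = m k by exact: lowest_inj lk (mP k).
  have [ki|ki] := eqVneq k i; last by have := zG _ ki; rewrite zk ltnn.
  by have := zG j; rewrite eq_sym ij -mij -ki -zk => /(_ isT); rewrite zk ki mij ltnn.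
(* Dominance of [S] at [z] must use order [i], since [z] beats the minima of all the other
   orders. *)
have zi x : x \in S -> R i z <= R i x.
  have /dominantP/(_ z)[k kP] := domS.
  have [<-|ki] := eqVneq k i; first exact: kP.
  have /lowestP[mS _] := mP k.
  by have := zG _ ki; rewrite ltnNge kP.
apply/dominantP => y; have [/aboveP yG|] := boolP (y \in above m i).
  have yz : R i y <= R i z by apply: zmax; apply/aboveP.
  exists i => x; rewrite !inE => /predU1P[->//|xS].
  exact: leq_trans yz (zi _ xS).
rewrite inE negb_forall => /existsP[k]; rewrite negb_imply -leqNgt => /andP[ki yk].
exists k => x; rewrite !inE => /predU1P[->|xS].
  exact: leq_trans yk (ltnW (zG _ ki)).
exact: leq_trans yk (mlow _ _ xS).
Qed.

(* A dominant set of |I| - 1 elements assigns its minima to |I| indices, so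
   exactly two indices [i], [j] share their minimum; an enlargement must
   replace one of these two. *)
Lemma dominant_collision S :
    S != set0 -> #|S|.+1 = #|I| -> dominant S ->
  exists m : I -> Z, exists i j,
  [/\ forall k, lowest S k (m k), i != j, m i = m j &
   forall z, z \notin S -> dominant (z |: S) ->
   exists2 l, l \in [:: i; j] &
     z \in above m l /\ forall y, y \in above m l -> R l y <= R l z].
Proof.
move=> S0 cardS domS.
have [m mP] := fin_all_exists (fun i => ex_lowest i S0).
have imS := lowest_image domS mP.
have [i [j [ij mij]]] : exists i j, i != j /\ m i = m j.
  have : ~~ injectiveb m.
    apply/negP => /injectiveP minj.
    by have := card_imset I minj; rewrite imS -cardS => /eqP; rewrite ltn_eqF.
  by case/injectivePn => i [j ij mij]; exists i, j.
exists m, i, j; split=> // z zS domz.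
have zS0 : z |: S != set0 by apply/set0Pn; exists z; rewrite setU11.
have [m' m'P] := fin_all_exists (fun i => ex_lowest i zS0).
have imzS := lowest_image domz m'P.
have m'inj : injective m'.
  have /imset_injP m'i : #|m' @: I| == #|I| by rewrite imzS cardsU1 zS add1n cardS.
  by move=> x y; apply: m'i.
have [l _ zl] : exists2 l, l \in I & z = m' l.
  by apply/imsetP; rewrite imzS setU11.
have zabove k : k != l -> R k (m k) < R k z.
  move=> kl; have /lowestP[m'S m'm] := m'P k; have /lowestP[mS _] := mP k.
  apply: (@leq_ltn_trans (R k (m' k))).
    have /lowestP[_] := mP k; apply; move: m'S; rewrite !inE => /predU1P[|//].
    by rewrite zl => /m'inj /eqP; rewrite (negbTE kl).
  rewrite ltn_neqAle m'm ?setU11 // andbT.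
  by apply/eqP => /R_inj; rewrite zl => /m'inj /eqP; rewrite (negbTE kl).
exists l; last first.
  split; first exact/aboveP.
  move=> y /aboveP yG; have /dominantP/(_ y)[k kP] := domz.
  have [<-|kl] := eqVneq k l; first by rewrite kP ?setU11.
  have := yG _ kl; rewrite ltnNge kP //.
  by have /lowestP[mS _] := mP k; rewrite inE mS orbT.
(* Orders other than [l] keep their old minimum, so if [l] were neither [i] nor [j], the injective
   [m'] would identify [i] and [j]. *)
apply/negPn/negP; rewrite !inE negb_or => /andP[li lj].
have m'E k : k != l -> m' k = m k.
  move=> kl; apply: (@lowest_inj S k) (mP k).
  have /lowestP[m'S m'm] := m'P k; apply/lowestP; split.
    move: m'S; rewrite !inE => /predU1P[|//].
    by rewrite zl => /m'inj /eqP; rewrite (negbTE kl).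
  by move=> x xS; apply: m'm; rewrite inE xS orbT.
have /m'inj/eqP : m' i = m' j by rewrite !m'E // eq_sym.
by rewrite (negbTE ij).
Qed.

Definition enlargers S := [set z | (z \notin S) && dominant (z |: S)].

Lemma dominant_sub S S' : S \subset S' -> dominant S' -> dominant S.
Proof.
move=> /subsetP sub /dominantP dom; apply/dominantP => y.
by have [i iP] := dom y; exists i => x /sub; apply: iP.
Qed.

(** Each nonempty [above] set contributes its unique highest point. The two contributions differ,
    because a common point would beat the minima of all orders and contradict dominance. *)
Lemma card_enlargers S (m : I -> Z) i j :
    dominant S -> (forall k, lowest S k (m k)) -> i != j -> m i = m j ->
    (forall z, z \notin S -> dominant (z |: S) ->
     exists2 l, l \in [:: i; j] &
       z \in above m l /\ forall y, y \in above m l -> R l y <= R l z) ->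
  #|enlargers S| = (above m i != set0) + (above m j != set0).
Proof.
move=> domS mP ij mij sub.
pose top l := [set z in above m l | [forall y in above m l, R l y <= R l z]].
have topP l z : reflect (z \in above m l /\ forall y, y \in above m l -> R l y <= R l z)
    (z \in top l).
  apply: (iffP idP); first by rewrite in_set => /andP[? /forall_inP].
  by case=> zG zm; rewrite in_set zG; apply/forall_inP.
have -> : enlargers S = top i :|: top j.
  apply/setP => z; rewrite !in_setU inE; apply/andP/orP => [[zS dz]|].
    have [l lij /topP zl] := sub _ zS dz.
    by move: lij zl; rewrite in_cons mem_seq1 => /orP[]/eqP->; [left|right].
  case=> /topP[zG zm]; first exact: (dominant_setU1 mP domS ij mij).
  by apply: (dominant_setU1 mP domS _ (esym mij)) zG zm; rewrite eq_sym.
have ctop l : #|top l| = (above m l != set0).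
  have [G0|/set0Pn[z0 z0G]] := eqVneq (above m l) set0.
    by apply/eqP; rewrite cards_eq0; apply/eqP/setP => z; rewrite inE G0 !inE.
  case: (arg_maxnP (R l) z0G) => z zG zmax.
  apply/eqP/cards1P; exists z; apply/setP => x; rewrite [RHS]inE.
  apply/topP/eqP => [[xG xm]|->//].
  by apply: (R_inj (i := l)); apply/eqP; rewrite eqn_leq [R l x <= _]zmax //= xm.
rewrite cardsU !ctop (_ : _ :&: _ = set0) ?cards0 ?subn0 //.
apply/setP => z; rewrite !in_set0 in_setI; apply/negP => /andP[].
move=> /topP[/aboveP zi _] /topP[/aboveP zj _].
have /dominantP/(_ z)[k kP] := domS.
have /lowestP[mS _] := mP k.
have: R k (m k) < R k z.
  by have [ki|/zi//] := eqVneq k i; apply: zj; rewrite ki.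
by rewrite ltnNge kP.
Qed.

(* The point [slack i] is the least in the order [i] and colours itself [i];
   slack points stand for the facets of the simplex. *)
Variables (slack : I -> Z) (c : Z -> I).
Hypothesis c_slack : cancel slack c.
Hypothesis slack_low : forall i z, R i (slack i) <= R i z.
Hypothesis slack_high :
  forall i j z, i != j -> z \notin codom slack -> R i z < R i (slack j).

Lemma above_slack S (m : I -> Z) i :
    (forall k, lowest S k (m k)) -> ~~ (S \subset codom slack) -> slack i \notin S ->
  slack i \in above m i.
Proof.
move=> mP /subsetPn[x xS xT] iS; apply/aboveP => k ki.
have /lowestP[_ /(_ _ xS) h] := mP k.
exact: leq_ltn_trans h (slack_high ki xT).
Qed.

(** If [S] contains a non-slack point, both [above] sets contain a slack point and there are two
    enlargers. Otherwise the colours force [S] to consist of all slack points but [slack i0], and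
    only [slack i0] is left to open an enlargement. *)
Lemma odd_enlargers S i0 :
    (1 < #|I|) -> #|S|.+1 = #|I| -> dominant S -> c @: S = [set~ i0] ->
  odd #|enlargers S| = (S == slack @: [set~ i0]).
Proof.
move=> I1 cardS domS cS.
have S0 : S != set0 by rewrite -card_gt0 -ltnS cardS.
have [m [i [j [mP ij mij sub]]]] := dominant_collision S0 cardS domS.
rewrite (card_enlargers domS mP ij mij sub).
have slackS k : slack k \in S -> m k = slack k.
  move=> kS; apply: lowest_inj (mP k) _; apply/lowestP; split => //.
have slack_inj := can_inj c_slack.
have nslack k l : k != l -> m k = m l -> slack k \notin S \/ slack l \notin S.
  move=> kl mkl; have [/slackS mk|] := boolP (slack k \in S); last by left.
  right; apply/negP => /slackS ml; case/negP: kl; apply/eqP/slack_inj.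
  by rewrite -mk -ml.
have [sub0|nsub0] := boolP (S \subset codom slack); last first.
  have -> : (S == slack @: [set~ i0]) = false.
    apply: contraNF nsub0 => /eqP->.
    by apply/subsetP => _ /imsetP[k _ ->]; exact: codom_f.
  have nonempty k l : k != l -> m k = m l -> above m k != set0.
    move=> kl mkl; have [kS|kS] := boolP (slack k \in S); last first.
      by apply/set0Pn; exists (slack k); apply: above_slack.
    have lS : slack l \notin S by case: (nslack _ _ kl mkl); rewrite ?kS.
    have /subsetPn[x xS xT] := nsub0.
    have := slack_high (i := l) (j := k) (z := x); rewrite eq_sym => /(_ kl xT).
    have /lowestP[_ /(_ _ xS) h] := mP l.
    by move=> /(leq_ltn_trans h); rewrite -mkl (slackS _ kS) ltnn.
  by rewrite (nonempty _ _ ij mij) (nonempty j i) // eq_sym.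
have SE : S = slack @: [set~ i0].
  apply/setP => x; apply/idP/imsetP => [xS|[k]].
    have /codomP[k xk] := subsetP sub0 _ xS; exists k => //.
    by rewrite -cS -[k]c_slack -xk imset_f.
  rewrite -cS => /imsetP[x' x'S ->] ->.
  by have /codomP[k' x'k] := subsetP sub0 _ x'S; rewrite x'k c_slack -x'k.
rewrite SE eqxx.
have inS k : k != i0 -> slack k \in S by move=> ki; rewrite SE imset_f // !inE.
(* Minima at indices other than [i0] are distinct slack points, so one of the colliding indices [i],
   [j] is [i0] and this count settles the case. *)
have one k : k != i0 -> m k = m i0 -> (above m i0 != set0) + (above m k != set0) = 1.
  move=> ki mk.
  have -> : above m i0 != set0.
    apply/set0Pn; exists (slack i0); apply/aboveP => l li.
    rewrite (slackS _ (inS _ li)) ltn_neqAle slack_low andbT.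
    by apply: contraNneq li => /R_inj/slack_inj ->.
  suff -> : above m k = set0 by rewrite eqxx.
  apply/setP => y; rewrite in_set0; apply/negP => /aboveP yG.
  have yT : y \in codom slack.
    apply/negPn/negP => yT; have := yG i0; rewrite eq_sym ki => /(_ isT).
    rewrite -mk (slackS _ (inS _ ki)) ltnNge ltnW // slack_high //.
    by rewrite eq_sym.
  have /codomP[l yl] := yT; have [lk|lk] := eqVneq l k.
    have := yG i0; rewrite eq_sym ki => /(_ isT).
    by rewrite -mk (slackS _ (inS _ ki)) yl lk ltnn.
  by have := yG l lk; rewrite yl ltnNge slack_low.
have [ii0|ii0] := eqVneq i i0; first by rewrite -ii0 in one *; rewrite one // eq_sym.
have [ji0|ji0] := eqVneq j i0; first by rewrite -ji0 in one *; rewrite addnC one.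
by have := nslack _ _ ij mij; rewrite !inS //; case.
Qed.

(** If removing [z] leaves exactly the colours other than [i0], each once, then [z] shares its
    colour with exactly one other point [z'], and the removable points are [z] and [z']. *)
Lemma even_removals S i0 :
  #|S| = #|I| -> c @: S != setT ->
  odd #|[set z in S | c @: (S :\ z) == [set~ i0]]| = false.
Proof.
move=> cardS nfull; set X := [set z in S | _].
have [->|/set0Pn[z]] := eqVneq X set0; first by rewrite cards0.
have Xinj z' : z' \in X -> {in S :\ z' &, injective c}.
  rewrite inE => /andP[zS /eqP cz]; apply/imset_injP.
  by rewrite cz cardsC1 -cardS (cardsD1 z' S) zS.
move=> zX; have := zX; rewrite inE => /andP[zS /eqP cz].
have cS : c @: S = c z |: c @: (S :\ z) by rewrite -imsetU1 setD1K.
have : c z \in c @: (S :\ z).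
  rewrite cz !inE; apply: contraNneq nfull => czi.
  by rewrite cS cz czi setUCr.
case/imsetP => z' z'S czz'; move: (z'S); rewrite !inE => /andP[zz' z'S'].
suff -> : X = [set z; z'] by rewrite cards2 eq_sym zz'.
apply/setP => x; rewrite in_set2; apply/idP/orP => [xX|[]/eqP-> //].
  have [xz|xz] := eqVneq x z; first by left.
  have [xz'|xz'] := eqVneq x z'; first by right.
  have := Xinj _ xX z z'; rewrite !inE [z == x]eq_sym [z' == x]eq_sym xz xz' zS z'S'.
  by move=> /(_ isT isT czz') zE; rewrite zE eqxx in zz'.
rewrite inE z'S' /= -cz; apply/eqP/setP => y; apply/imsetP/imsetP => -[w].
  rewrite !inE => /andP[wz wS] ->; have [->|wz'] := eqVneq w z.
    by exists z'.
  by exists w; rewrite ?inE ?wz' ?wS.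
rewrite !inE => /andP[wz wS] ->; have [->|wz'] := eqVneq w z'.
  by exists z; rewrite ?inE 1?eq_sym ?zz'.
by exists w; rewrite ?inE ?wz' ?wS.
Qed.

Theorem scarf : 0 < #|I| -> exists S, [/\ #|S| = #|I|, dominant S & c @: S = setT].
Proof.
move=> I0; have [i0 _] := card_gt0P I0.
(* With a single index a door would be empty and have no minima; the highest point of the only order
   is a solution. *)
have [I1|I1] := leqP #|I| 1.
  have {I0}I1 : #|I| = 1 by apply/eqP; rewrite eqn_leq I1.
  have Iall i : i = i0.
    by have [x xP] := fintype1 I1; rewrite (xP i) (xP i0).
  case: (@arg_maxnP _ (slack i0) xpredT (R i0) isT) => z _ zmax.
  exists [set z]; split; first by rewrite cards1 I1.
    by apply/dominantP => y; exists i0 => x; rewrite inE => /eqP->; apply: zmax.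
  by apply/setP => i; rewrite imset_set1 !inE [i]Iall [c z]Iall eqxx.
pose room S := (#|S| == #|I|) && dominant S.
have [/exists_inP[S]|none] :=
    boolP [exists S : {set Z} in [set S | room S], c @: S == setT].
  by rewrite inE => /andP[/eqP ? ?] /eqP; exists S.
pose door S := [&& #|S|.+1 == #|I|, dominant S & c @: S == [set~ i0]].
(* Counted by their first component, these pairs are odd in number: every
   door has two enlargements except the one made of slack points.  Counted by
   the room [z |: S], they would be even if no room had all colours. *)
pose pairs := [set p : {set Z} * Z | door p.1 && (p.2 \in enlargers p.1)].
have slackc : c @: (slack @: [set~ i0]) = [set~ i0].
  by rewrite -imset_comp (eq_imset _ c_slack) imset_id.
have door_slack : door (slack @: [set~ i0]).
  rewrite /door slackc eqxx andbT card_imset; last exact: can_inj c_slack.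
  rewrite cardsC1 prednK // eqxx /=; apply/dominantP => y.
  have [/codomP[k ->]|yT] := boolP (y \in codom slack); first by exists k.
  exists i0 => z /imsetP[k]; rewrite !inE => ki ->.
  by rewrite ltnW // slack_high // eq_sym.
have odd_pairs : odd #|pairs|.
  have -> : #|pairs| = \sum_(S | door S) #|enlargers S|.
    rewrite -sum1_card (eq_bigl (fun p => door p.1 && (p.2 \in enlargers p.1))).
      rewrite -(pair_big_dep door (fun S z => z \in enlargers S)
        (fun _ _ => 1%N)) /=.
      by apply: eq_bigr => S _; rewrite sum1_card.
    by move=> p; rewrite inE.
  rewrite (bigD1 _ door_slack) /= oddD.
  have oddE S : door S -> odd #|enlargers S| = (S == slack @: [set~ i0]).
    by case/and3P => /eqP ? ? /eqP; apply: odd_enlargers.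
  rewrite oddE // eqxx (big_morph odd oddD (erefl (odd 0))) big1 // => S /andP[dS].
  by rewrite oddE // => /negbTE.
suff even_pairs : ~~ odd #|pairs| by rewrite odd_pairs in even_pairs.
have -> : #|pairs| =
    \sum_(S | room S) #|[set z in S | c @: (S :\ z) == [set~ i0]]|.
  pose f (p : {set Z} * Z) := (p.2 |: p.1, p.2).
  have f_inj : {in pairs &, injective f}.
    move=> [S z] [S' z']; rewrite !inE /=.
    move=> /andP[_ /andP[zS _]] /andP[_ /andP[zS' _]].
    case=> + zz'; rewrite -zz' in zS' * => /(congr1 (fun A => A :\ z)).
    by rewrite !setU1K // => ->.
  rewrite -(card_in_imset f_inj) -sum1_card.
  pose removal (S : {set Z}) z := z \in [set z in S | c @: (S :\ z) == [set~ i0]].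
  rewrite (eq_bigl (fun p => room p.1 && removal p.1 p.2)).
    rewrite -(pair_big_dep room removal (fun _ _ => 1%N)) /=.
    by apply: eq_bigr => S _; rewrite sum1_card.
  move=> [S z]; apply/imsetP/idP => /=.
    case=> -[S' z']; rewrite !inE /=.
    move=> /andP[/and3P[/eqP cS' _ /eqP cc] /andP[zS' dz]] [-> ->].
    by rewrite /removal inE setU11 setU1K // /room cardsU1 zS' add1n cS' dz cc !eqxx.
  rewrite /removal inE => /andP[/andP[/eqP cS dS] /andP[zS cc]]; exists (S :\ z, z).
    rewrite inE /door /= cc inE in_setD1 eqxx setD1K // dS -cS (cardsD1 z S) zS.
    by rewrite add1n eqxx (dominant_sub _ dS) ?subD1set.
  by rewrite /f /= setD1K.
rewrite (big_morph odd oddD (erefl (odd 0))) big1 // => S /andP[/eqP cS dS].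
apply: even_removals => //; apply: contra none => cT.
by apply/exists_inP; exists S => //; rewrite inE /room cS eqxx.
Qed.
End Scarf.

(** * Scarf's lemma on the integer grid of a simplex *)

Definition grid n N := {x : {ffun 'I_n -> 'I_N.+1} | \sum_i x i == N}.

Section Grid.
Variables (n N : nat) (c : grid n N -> 'I_n).
Let G : finType := grid n N.

Let crd (x : G) (i : 'I_n) : nat := sval x i.

(* Grid points are ordered by their [i]-th coordinate, ties being broken by
   their enumeration; the points [inr j] are the slack points. *)
Let rank i (z : (G + 'I_n)%type) : nat :=
  match z with
  | inl x => (crd x i * #|G| + enum_rank x).+1
  | inr j => if j == i then 0 else (N.+1 * #|G| + j).+1
  end.

Let colour (z : (G + 'I_n)%type) := match z with inl x => c x | inr j => j end.

Let rank_lt i j x : j != i -> rank i (inl x) < rank i (inr j).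
Proof.
move=> /negbTE /= ->; rewrite ltnS mulSn.
have := ltn_ord (enum_rank x); have := ltn_ord (sval x i); rewrite ltnS /crd => h1 h2.
have := leq_mul h1 (leqnn #|G|); move: h2; clear.
move: (_ * #|G|) (N * #|G|) => a b.
by move: #|G| (enum_rank x) => g /=; lia.
Qed.

Let rank_mono i (x y : G) : crd x i < crd y i -> rank i (inl x) < rank i (inl y).
Proof.
move=> xy; rewrite /= ltnS; have := ltn_ord (enum_rank x).
have := leq_mul xy (leqnn #|G|); rewrite mulSn.
move: #|G| (enum_rank x) (enum_rank y) (_ * #|G|) (crd y i * #|G|).
by move=> g /= ex ey a b; lia.
Qed.

Let rank_inj i : injective (rank i).
Proof.
move=> [x|j] [y|k] //=.
- move=> e; have [xy|xy|xy] := ltngtP (crd x i) (crd y i).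
  + by have := rank_mono xy; rewrite /= e ltnn.
  + by have := rank_mono xy; rewrite /= e ltnn.
  + by move: e => [] /eqP; rewrite xy eqn_add2l => /eqP /val_inj /enum_rank_inj ->.
- move=> e; have [ki|ki] := eqVneq k i; first by rewrite ki eqxx in e.
  by have := rank_lt x ki; rewrite /= e ltnn.
- move=> e; have [ki|ki] := eqVneq j i; first by rewrite ki eqxx in e.
  by have := rank_lt y ki; rewrite /= e ltnn.
- have [->|ji] := eqVneq j i; have [->|ki] := eqVneq k i => //.
  by move=> [] /eqP; rewrite eqn_add2l => /eqP /val_inj ->.
Qed.

(** Let [S] be dominant with all colours and [C] the set of indices whose slack point is outside
    [S]. The minima over the grid points of [S] of the coordinates in [C] fall short of [N] in total
    by less than [n], or some grid point would exceed them all. Hence these points agree up to [n],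
    and their coordinates outside [C] are at most [n]. *)
Lemma grid_scarf : 0 < n ->
  exists p : 'I_n -> grid n N,
    (forall i, c (p i) = i \/ sval (p i) i <= n) /\
    forall i j k, sval (p i) k <= sval (p j) k + n.
Proof.
move=> n0.
have slack_low i z : rank i (inr i) <= rank i z by rewrite /= eqxx.
have slack_high i j z : i != j -> z \notin codom inr -> rank i z < rank i (inr j).
  case: z => [x|k] ij; last by rewrite codom_f.
  by move=> _; apply: rank_lt; rewrite eq_sym.
have colourK : cancel (@inr G 'I_n) colour by [].
have [|S [cardS domS cS]] := scarf rank_inj colourK slack_low slack_high.
  by rewrite card_ord.
have low i y : inr i \in S -> (forall z, z \in S -> rank i y <= rank i z) -> y = inr i.
  move=> iS /(_ _ iS); rewrite /= eqxx leqn0 => /eqP e.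
  by apply: (rank_inj (i := i)); rewrite e /= eqxx.
have y0 : G.
  exists [ffun i => if i == Ordinal n0 then ord_max else ord0].
  apply/eqP; rewrite (bigD1 (Ordinal n0)) //= ffunE eqxx big1 ?addn0 //.
  by move=> i /negbTE i0; rewrite ffunE i0.
have /dominantP dS := domS.
pose C := [set i | inr i \notin S].
(* Dominance at a grid point never uses an index whose slack point is in [S], because that slack
   point has rank 0 there. *)
have domC y : exists2 i, i \in C & forall z, z \in S -> rank i (inl y) <= rank i z.
  have [i iP] := dS (inl y); exists i => //; rewrite inE.
  by apply/negP => iS; have := low _ _ iS iP.
have pickC i : i \in C -> exists x, inl x \in S /\ c x = i.
  rewrite inE => iC; have : i \in colour @: S by rewrite cS.
  by case/imsetP => -[x|j] zS e; [exists x | rewrite -[j]e in zS; rewrite zS in iC].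
have [i1 i1C _] := domC y0.
have [x0 [x0S _]] := pickC _ i1C.
pose m i : nat := crd [arg min_(x < x0 | inl x \in S) crd x i] i.
have mP i : (exists2 x, inl x \in S & crd x i = m i) /\
    forall x, inl x \in S -> m i <= crd x i.
  by rewrite /m; case: arg_minnP => // x xS xm; split=> //; exists x.
have summ : N < \sum_(i in C) (m i).+1.
  rewrite ltnNge; apply/negP => le.
  (* Coordinates in [C] are set one above the minima and what remains of [N] is put on [i1];
     dominance at this point fails in every order of [C]. *)
  pose rest := N - \sum_(i in C) (m i).+1.
  pose y i := if i \in C then (m i).+1 + (i == i1) * rest else 0.
  have sumy : \sum_i y i = N.
    rewrite (bigID (mem C)) /= [X in _ + X]big1 ?addn0; last first.
      by move=> i /negbTE; rewrite /y => ->.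
    rewrite (eq_bigr (fun i => (m i).+1 + (i == i1) * rest)); last first.
      by move=> i iC; rewrite /y iC.
    rewrite big_split /= -[X in _ + X]big_distrl /=.
    rewrite [X in _ + X * _](_ : _ = 1) ?mul1n ?subnKC //.
    by rewrite (bigD1 i1) //= eqxx big1 // => i /andP[_ /negbTE ->].
  have yN i : y i < N.+1 by rewrite ltnS -sumy (bigD1 i) //= leq_addr.
  pose Y : {ffun 'I_n -> 'I_N.+1} := [ffun i => Ordinal (yN i)].
  have sumY : \sum_i Y i == N.
    by apply/eqP; rewrite -[RHS]sumy; apply: eq_bigr => i _; rewrite ffunE.
  pose gridpt (x : {ffun 'I_n -> 'I_N.+1}) := \sum_i x i == N.
  have [i iC iP] := domC (exist gridpt Y sumY).
  have [[x xS xm] _] := mP i.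
  have := iP _ xS; rewrite leqNgt rank_mono //.
  by rewrite xm /crd /= ffunE /= /y iC addSn ltnS leq_addr.
have sumC : N < \sum_(i in C) m i + n.
  apply: leq_trans summ _; under eq_bigr do rewrite -addn1.
  by rewrite big_split /= sum1_card leq_add2l -[X in _ <= X]card_ord max_card.
have sumx x : inl x \in S -> \sum_(i in C) crd x i + \sum_(i | i \notin C) crd x i = N.
  by move=> xS; rewrite -[RHS](eqP (valP x)) [RHS](bigID (mem C)).
have boundC x k : inl x \in S -> k \in C -> crd x k <= m k + n.
  move=> xS kC; have := sumx _ xS; move: sumC.
  rewrite (bigD1 k) //= [X in X + _ = _](bigD1 k) //=.
  have : \sum_(i in C | i != k) m i <= \sum_(i in C | i != k) crd x i.
    by apply: leq_sum => i _; apply: (mP i).2.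
  move: (\sum_(i in C | _) m i) (\sum_(i in C | _) crd x i).
  by move: (\sum_(i | i \notin C) crd x i) (m k) (crd x k); clear; lia.
have boundNC x k : inl x \in S -> k \notin C -> crd x k <= n.
  move=> xS kC; have := sumx _ xS; move: sumC; rewrite [X in _ + X = _](bigD1 k) //=.
  have : \sum_(i in C) m i <= \sum_(i in C) crd x i.
    by apply: leq_sum => i _; apply: (mP i).2.
  move: (\sum_(i in C) m i) (\sum_(i in C) crd x i).
  by move: (\sum_(i | _ && _) crd x i) (crd x k); clear; lia.
have bound x x' k : inl x \in S -> inl x' \in S -> crd x k <= crd x' k + n.
  move=> xS x'S; have [kC|kC] := boolP (k \in C).
    by apply: leq_trans (boundC _ _ xS kC) _; rewrite leq_add2r (mP k).2.
  by apply: leq_trans (boundNC _ _ xS kC) (leq_addl _ _).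
(* The colour of an index of [C] must be carried by a grid point of [S]; for the other indices any
   grid point of [S] serves. *)
have choose i : exists x, inl x \in S /\ (c x = i \/ crd x i <= n).
  have [/pickC[x [xS cx]]|iC] := boolP (i \in C); first by exists x; split; [|left].
  by exists x0; split => //; right; apply: boundNC.
have [p pP] := fin_all_exists choose.
exists p; split=> [i|i j k]; first by have [_] := pP i.
by apply: bound; [have [] := pP i | have [] := pP j].
Qed.
End Grid.

(** * The KKM theorem and Ky Fan's inequality *)

From HB Require Import structures.
From mathcomp Require Import all_order all_algebra finmap.
From mathcomp Require Import all_classical all_reals all_analysis ring lra.
Import Order.TTheory GRing.Theory Num.Theory.
Import numFieldNormedType.Exports.
Local Open Scope classical_set_scope.
Local Open Scope ring_scope.

Lemma continuous_bigsum (R : realType) (V : normedModType R)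
    (T : topologicalType) (J : Type) (r : seq J) (f : J -> T -> V) :
  (forall j, continuous (f j)) -> continuous (fun x => \sum_(j <- r) f j x).
Proof.
move=> fc; elim: r => [|j r IH].
  rewrite (_ : (fun _ => _) = cst 0); first exact: cst_continuous.
  by apply/funext => x; rewrite big_nil.
rewrite (_ : (fun _ => _) = (fun x => f j x + \sum_(i <- r) f i x)).
  by move=> x; apply: cvgD; [exact: fc | exact: IH].
by apply/funext => x; rewrite big_cons.
Qed.

Lemma closed_le_continuous (R : realType) (T : topologicalType) (f g : T -> R) :
  continuous f -> continuous g -> closed [set x | f x <= g x].
Proof.
move=> fc gc.
have -> : [set x | f x <= g x] = (fun x => g x - f x) @^-1` [set y | 0 <= y].
  by apply/seteqP; split=> x /=; rewrite subr_ge0.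
have /continuous_closedP : continuous (fun x => g x - f x).
  by move=> x; apply: cvgB; [exact: gc | exact: fc].
by apply; exact: closed_ge.
Qed.

Lemma closed_eq_continuous (R : realType) (T : topologicalType) (f g : T -> R) :
  continuous f -> continuous g -> closed [set x | f x = g x].
Proof.
move=> fc gc.
have -> : [set x | f x = g x] = [set x | f x <= g x] `&` [set x | g x <= f x].
  apply/seteqP; split=> [x /= ->//|x [/= h1 h2]].
  by apply/eqP; rewrite eq_le h1.
by apply: closedI; exact: closed_le_continuous.
Qed.

(** * A KKM covering theorem on the standard simplex *)

Section KKM.
Variables (R : realType) (n : nat).

Definition simplex : set 'rV[R]_n :=
  [set t | (forall i, 0 <= t 0 i) /\ \sum_i t 0 i = 1].

Lemma simplex_compact : compact simplex.
Proof.
apply: (subclosed_compact _ (@rV_compact R n _ (fun=> @segment_compact R 0 1))).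
- have -> : simplex = (\bigcap_(i : 'I_n) [set t | 0 <= t 0 i]) `&`
      [set t | \sum_i t 0 i = 1].
    by apply/seteqP; split=> [t [t0 t1]|t [t0 t1]]; split => // i; [move=> _|]; exact: t0.
  apply: closedI.
    apply: closed_bigI => i _.
    apply: (@closed_le_continuous R _ (cst 0) (fun t : 'rV[R]_n => t 0 i)).
      exact: cst_continuous.
    exact: coord_continuous.
  apply: (@closed_eq_continuous R _ (fun t : 'rV[R]_n => \sum_i t 0 i) (cst 1)).
    by apply: (@continuous_bigsum R R^o) => i; exact: coord_continuous.
  exact: cst_continuous.
move=> t [t0 t1] i /=; rewrite in_itv /= t0 /= -t1 (bigD1 i) //= lerDl.
by apply: sumr_ge0.
Qed.

Lemma approximate_kkm (A : 'I_n -> set 'rV[R]_n) (N : nat) : (0 < n)%N ->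
    (forall t, simplex t -> exists i, A i t) ->
  exists p : 'I_n -> 'rV[R]_n,
    [/\ forall i, simplex (p i),
        forall i, A i (p i) \/ p i 0 i <= n%:R / N.+1%:R &
        forall i j k, `|p i 0 k - p j 0 k| <= n%:R / N.+1%:R].
Proof.
move=> n0 cover.
have N0 : 0 < N.+1%:R^-1 :> R by rewrite invr_gt0 ltr0n.
pose pt (x : grid n N.+1) : 'rV[R]_n := \row_k ((sval x k)%:R / N.+1%:R).
have ptS x : simplex (pt x).
  split=> [i|]; first by rewrite mxE divr_ge0.
  under eq_bigr do rewrite mxE.
  by rewrite -mulr_suml -natr_sum (eqP (valP x)) divff.
have [c cP] := choice (fun x => cover _ (ptS x)).
have [p [pc pd]] := grid_scarf c n0.
exists (fun i => pt (p i)); split=> [i|i|i j k]; first exact: ptS.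
  have [ci|pi] := pc i; [left|right]; first by rewrite -{1}ci; exact: cP.
  by rewrite mxE ler_pM2r // ler_nat.
rewrite !mxE -mulrBl normrM [X in _ * X]gtr0_norm // ler_pM2r //.
rewrite ler_norml; have := pd i j k; have := pd j i k.
by rewrite -!(ler_nat R) !natrD => h1 h2; apply/andP; split; lra.
Qed.

(** In this form of KKM each set contains the facet opposite its vertex. A cluster point [z] of the
    approximate families lies in [A i]: by the facet condition if [z 0 i = 0], and otherwise because
    the points [p N i] close to [z] lie in [A i]. *)
Lemma kkm (A : 'I_n -> set 'rV[R]_n) : (0 < n)%N ->
    (forall i, closed (A i)) ->
    (forall t, simplex t -> exists i, A i t) ->
    (forall t i, simplex t -> t 0 i = 0 -> A i t) ->
  exists2 t, simplex t & forall i, A i t.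
Proof.
move=> n0 Acl cover Abd.
have [p pP] := choice (fun N => approximate_kkm N n0 cover).
pose i0 := Ordinal n0.
have [|z [zS zcl]] := @simplex_compact ((fun N => p N i0) @ \oo) _.
  by exists 0%N => // N _; have [+ _ _] := pP N; apply.
exists z => // i.
have [zi|zi] := eqVneq (z 0 i) 0; first exact: Abd.
have zi0 : 0 < z 0 i by rewrite lt_neqAle eq_sym zi /=; case: zS.
apply: Acl => B /nbhs_ballP[e /= e0 eB].
(* The bound [e] keeps [p N i] in the given ball; the bound [z 0 i / 2] keeps its coordinate [i]
   above the mesh bound, so that [p N i] must lie in [A i]. *)
pose e' := Num.min e (z 0 i / 2).
have e'0 : 0 < e' by rewrite lt_min e0 divr_gt0.
have [N0 N0P] : exists N0, forall N, (N0 <= N)%N -> n%:R / N.+1%:R < e' / 2.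
  exists (Num.truncn (n%:R / (e' / 2))).+1 => N le.
  rewrite ltr_pdivrMr ?ltr0n // -ltr_pdivrMl ?divr_gt0 // mulrC.
  apply: lt_trans (truncnS_gt _) _.
  by rewrite ltr_nat ltnS.
have [||y [[N NN0 <-] zy]] :=
    zcl [set p N i0 | N in [set N | (N0 <= N)%N]] (ball z (e' / 2)).
- by exists N0 => // N NN0; exists N.
- by apply: nbhsx_ballx; rewrite divr_gt0.
have [pS pA pd] := pP N.
have close k : `|z 0 k - p N i 0 k| < e'.
  have : `|z 0 k - p N i0 0 k| < e' / 2 by case: zy => _; apply.
  move=> zp; apply: le_lt_trans (ler_distD (p N i0 0 k) _ _) _.
  by rewrite [ltRHS]splitr ltrD // (le_lt_trans (pd _ _ _)) // N0P.
have e'e : e' <= e by rewrite ge_min lexx.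
have e'z : e' <= z 0 i / 2 by rewrite ge_min lexx orbT.
exists (p N i); split.
  case: (pA i) => // pi; exfalso.
  have := close i; rewrite ltr_norml => /andP[h1 h2]; have := N0P _ NN0.
  by move: pi; move: (n%:R / _) => a; lra.
apply: eB; split=> // a b; rewrite [a]ord1; exact: lt_le_trans (close b) e'e.
Qed.
End KKM.

(** * Ky Fan's inequality on a compact convex set *)

Section KyFan.
Variables (R : realType) (E : normedModType R).

(** Points of weight 0 may lie outside [A], a freedom used in [ky_fan_finite]. The induction runs
    over normalised partial sums of positive total weight. *)
Lemma convex_sum (A : set E) n (t : 'I_n -> R) (y : 'I_n -> E) :
    (forall x z a, A x -> A z -> 0 <= a <= 1 -> A (a *: x + (1 - a) *: z)) ->
    (forall i, 0 <= t i) -> \sum_i t i = 1 -> (forall i, 0 < t i -> A (y i)) ->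
  A (\sum_i t i *: y i).
Proof.
move=> Aconv t0 t1 yA.
suff gen (r : seq 'I_n) : 0 < \sum_(i <- r) t i ->
    A ((\sum_(i <- r) t i)^-1 *: \sum_(i <- r) t i *: y i).
  by have := gen (index_enum 'I_n); rewrite t1 invr1 scale1r; apply.
elim: r => [|j r IH]; first by rewrite big_nil ltxx.
rewrite !big_cons; have [tj|tj] := ltP 0 (t j); last first.
  have -> : t j = 0 by apply/eqP; rewrite eq_le tj t0.
  by rewrite scale0r !add0r.
have r0 : 0 <= \sum_(i <- r) t i by apply: sumr_ge0.
move: r0; rewrite le_eqVlt => /predU1P[r0 _|r0 s0].
  rewrite -r0 addr0 [X in _ + X]big_seq big1 ?addr0; last first.
    move=> i ir; suff -> : t i = 0 by rewrite scale0r.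
    apply/eqP; move/esym/eqP: r0; rewrite psumr_eq0; last by move=> *; exact: t0.
    by move/allP/(_ _ ir).
  by rewrite scalerA mulVf ?gt_eqF // scale1r; exact: yA.
set s := \sum_(i <- r) t i in r0 s0 *; set w := \sum_(i <- r) _ *: _ in IH *.
have := Aconv _ _ (t j / (t j + s)) (yA _ tj) (IH r0).
have -> : 1 - t j / (t j + s) = s / (t j + s) by field; rewrite gt_eqF.
rewrite scalerA (_ : s / (t j + s) * s^-1 = (t j + s)^-1); last first.
  by field; rewrite !gt_eqF.
rewrite scalerDr scalerA [_^-1 * t j]mulrC; apply.
rewrite divr_ge0 ?(ltW tj) ?(ltW s0) //=.
by rewrite ler_pdivrMr // mul1r lerDl ltW.
Qed.

Variables (K : set E) (phi : E -> E -> R).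
Hypothesis K_convex :
  forall x z a, K x -> K z -> 0 <= a <= 1 -> K (a *: x + (1 - a) *: z).
Hypothesis phi_continuous : forall y, K y -> continuous (phi^~ y).
Hypothesis phi_convex : forall x y z a, K x -> K y -> K z -> 0 <= a <= 1 ->
  phi x (a *: y + (1 - a) *: z) <= a * phi x y + (1 - a) * phi x z.
Hypothesis phi_diag : forall x, K x -> 0 <= phi x x.

Lemma ky_fan_finite n (y : 'I_n -> E) : (0 < n)%N -> (forall i, K (y i)) ->
  exists2 x, K x & forall i, 0 <= phi x (y i).
Proof.
move=> n0 yK.
pose X (t : 'rV[R]_n) := \sum_i t 0 i *: y i.
pose g (i : 'I_n) t := Num.max 0 (- phi (X t) (y i)).
pose G t := \sum_i g i t.
have Xc : continuous X.
  apply: continuous_bigsum => i t.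
  apply: (@continuousZ _ _ _ (fun t : 'rV[R]_n => t 0 i) (fun=> y i)).
    exact: coord_continuous.
  exact: cst_continuous.
have phiXc i : continuous (fun t => phi (X t) (y i)).
  move=> t; apply: (@continuous_comp _ _ _ X (phi^~ (y i))); first exact: Xc.
  exact: phi_continuous.
have gc i : continuous (g i).
  move=> t; apply: (@continuous_max R _ (cst 0) (fun t => - phi (X t) (y i))).
    exact: cst_continuous.
  by apply: continuousN; exact: phiXc.
have Gc : continuous G by exact: (@continuous_bigsum R R^o).
have g0 i t : 0 <= g i t by rewrite le_max lexx.
have G0 t : 0 <= G t by apply: sumr_ge0.
(* As in Nash's fixed-point map, [g i] measures the violation at [y i] and a common point has
   [t 0 i * G t <= g i t] for all [i]. The sets cover because both sides have the same sum over
   [i]. *)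
have [i|t [t0 t1]|t i _ ti|t [t0 t1] tP] :=
    @kkm R n (fun i => [set t : 'rV[R]_n | t 0 i * G t <= g i t]) n0.
- apply: closed_le_continuous; last exact: gc.
  have cc : continuous (fun t : 'rV[R]_n => t 0 i) by exact: coord_continuous.
  move=> t; apply: (@continuousM _ _ (fun t : 'rV[R]_n => t 0 i) G).
    exact: cc.
  exact: Gc.
- apply: contrapT => /forallNP no.
  have : \sum_i g i t < \sum_i t 0 i * G t.
    apply: ltr_sum => [|i _]; first by apply/hasP; exists (Ordinal n0).
    by have /negP := no i; rewrite -ltNge.
  by rewrite -mulr_suml t1 mul1r ltxx.
- by rewrite /= ti mul0r.
have KX : K (X t) by apply: convex_sum => // i _; exact: yK.
exists (X t) => //.
(* If [phi (X t)] were negative at every [y i] of positive weight, convexity would make it negative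
   at [X t] itself. At the index found, [g i t = 0] with [t 0 i > 0], which forces [G t = 0]. *)
have [i ti phi0] : exists2 i, 0 < t 0 i & 0 <= phi (X t) (y i).
  apply: contrapT => no.
  have [] : (K `&` [set z | phi (X t) z < 0]) (X t); last first.
    by move=> _ /=; rewrite ltNge phi_diag.
  apply: convex_sum => // [x z a [Kx px] [Kz pz] a01|i ti].
    split; first exact: K_convex.
    apply: le_lt_trans (phi_convex KX Kx Kz a01) _.
    by move: px pz a01 => /=; move: (phi _ x) (phi _ z) => p q *; nra.
  by split; [exact: yK|rewrite /= ltNge; apply/negP => ?; apply: no; exists i].
have Gt : G t = 0.
  apply/eqP; rewrite eq_le G0 andbT -(pmulr_rle0 _ ti).
  by apply: le_trans (tP i) _; rewrite ge_max lexx oppr_le0.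
move=> j; have : g j t <= 0.
  by rewrite -Gt /G (bigD1 j) //= lerDl sumr_ge0.
by rewrite ge_max oppr_le0 => /andP[].
Qed.

Lemma ky_fan : compact K -> K !=set0 -> exists2 x, K x & forall y, K y -> 0 <= phi x y.
Proof.
rewrite compact_In0 => Kcompact [y0 Ky0].
have [||x xP] := Kcompact E K (fun y => K `&` [set x | 0 <= phi x y]).
- exists (fun y => [set x | 0 <= phi x y]) => // y Ky.
  apply: closed_le_continuous; first exact: cst_continuous.
  exact: phi_continuous.
- move=> D DK.
  have [->|/fset0Pn[d dD]] := eqVneq D fset0; first by exists y0.
  have [||x Kx xP] := @ky_fan_finite #|` D| (fun i => nth d D i).
  + by rewrite cardfs_gt0; apply/fset0Pn; exists d.
  + by move=> i; have /set_mem := DK _ (mem_nth d (ltn_ord i)).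
  exists x => z /= zD; split => //=.
  have zi : (index z D < #|` D|)%N by rewrite index_mem.
  by have := xP (Ordinal zi); rewrite /= nth_index.
exists x; first by have [] := xP _ Ky0.
by move=> y Ky; have [] := xP _ Ky.
Qed.
End KyFan.

(** * The traffic matrix *)

Section Traffic.
Variables (R : realType) (nB : nat) (Q : 'M[R]_nB).
Hypotheses (hQ : substochastic Q) (hleave : eventually_leave Q).

Lemma expmx_ge0 k i j : 0 <= (Q ^+ k) i j.
Proof.
elim: k i j => [|k IH] i j; first by rewrite expr0 mxE; case: eqP.
by rewrite exprS mxE; apply: sumr_ge0 => l _; rewrite mulr_ge0 // hQ.1.
Qed.

(* Iterating [Q^T u <= u] gives [(Q^T)^k u <= u], and [Q^k] tends to 0. *)
Lemma routing_ge0 (u : 'cV[R]_nB) :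
  (forall b, (Q^T *m u) b 0 <= u b 0) -> forall b, 0 <= u b 0.
Proof.
move=> hu b.
have iter k : \sum_j (Q ^+ k) j b * u j 0 <= u b 0.
  elim: k b => [|k IH] b.
    rewrite (bigD1 b) //= big1 ?addr0 ?expr0 ?mxE ?eqxx ?mul1r // => j jb.
    by rewrite mxE (negbTE jb) mul0r.
  apply: le_trans (IH b).
  have -> : \sum_j (Q ^+ k.+1) j b * u j 0 = \sum_l (Q ^+ k) l b * (Q^T *m u) l 0.
    under eq_bigr do rewrite exprS mxE mulr_suml.
    rewrite exchange_big /=; apply: eq_bigr => l _; rewrite mxE mulr_sumr.
    by apply: eq_bigr => j _; rewrite mxE; ring.
  by apply: ler_sum => l _; rewrite ler_wpM2l // expmx_ge0.
(* A lower bound for the iterates: each entry of [Q ^+ k] is at most its row sum, and the row sums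
   tend to 0. *)
have lim0 (r : seq 'I_nB) :
    (fun k => \sum_(j <- r) (\sum_i (Q ^+ k) j i) * - `|u j 0|) @ \oo --> (0 : R).
  elim: r => [|j r IH].
    rewrite (_ : (fun _ => _) = cst 0); first exact: cvg_cst.
    by apply/funext => k; rewrite big_nil.
  rewrite (_ : (fun _ => _) = (fun k => (\sum_i (Q ^+ k) j i) * - `|u j 0|
      + \sum_(j <- r) (\sum_i (Q ^+ k) j i) * - `|u j 0|)); last first.
    by apply/funext => k; rewrite big_cons.
  by have := cvgD (cvgM (hleave j) (cvg_cst (- `|u j 0|))) IH; rewrite mul0r addr0; apply.
apply: (@cvgr_to_le _ _ _ _ _ _ _ (lim0 (index_enum 'I_nB))).
apply: nearW => k; apply: le_trans (iter k); apply: ler_sum => j _.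
rewrite mulrN lerNl -mulrN.
apply: (@le_trans _ _ ((Q ^+ k) j b * `|u j 0|)).
  by rewrite ler_wpM2l ?expmx_ge0 // -normrN ler_norm.
rewrite ler_wpM2r // (bigD1 b) //= lerDl.
by apply: sumr_ge0 => i _; exact: expmx_ge0.
Qed.

(** A kernel vector is fixed by [Q^T], so [routing_ge0] applies to it and to its opposite. *)
Lemma routing_unitmx : 1%:M - Q^T \in unitmx.
Proof.
rewrite -unitmx_tr raddfB /= trmx1 trmxK -row_free_unit.
apply: inj_row_free => v; rewrite mulmxBr mulmx1 => /subr0_eq vQ.
have vT : Q^T *m v^T = v^T by rewrite -trmx_mul -vQ.
have v0 b : 0 <= v^T b 0 by apply: routing_ge0 => c; rewrite vT.
have v1 b : 0 <= (- v^T) b 0 by apply: routing_ge0 => c; rewrite mulmxN vT.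
apply/rowP => b; rewrite mxE; apply/eqP; rewrite eq_le.
by have := v0 b; have := v1 b; rewrite !mxE oppr_ge0 => -> ->.
Qed.

Variables (gamma mu : 'rV[R]_nB).
Hypotheses (hgamma : forall b, 0 < gamma 0 b) (hmu : forall b, 0 < mu 0 b).

Lemma invmx_diag_mulE (d : 'rV[R]_nB) (u : 'cV[R]_nB) b :
  (forall b, 0 < d 0 b) -> (invmx (diag_mx d) *m u) b 0 = u b 0 / d 0 b.
Proof.
move=> d0; pose w : 'cV[R]_nB := \col_b (u b 0 / d 0 b).
have dU : diag_mx d \in unitmx.
  by rewrite unitmxE det_diag unitfE; apply/prodf_neq0 => i _; rewrite gt_eqF.
have -> : u = diag_mx d *m w.
  by apply/colP => i; rewrite mul_diag_mx !mxE mulrC divfK // gt_eqF.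
by rewrite mulKmx // mul_diag_mx !mxE [d 0 b * _]mulrC mulfK // gt_eqF.
Qed.

Lemma traffic_mxE (rho : 'cV[R]_nB) b :
  (traffic_mx gamma mu Q *m rho) b 0 =
  ((1%:M - Q^T) *m \col_b (rho b 0 / mu 0 b)) b 0 / gamma 0 b.
Proof.
rewrite /traffic_mx -!mulmxA invmx_diag_mulE //; congr ((_ *m _) b 0 / _).
by apply/colP => i; rewrite invmx_diag_mulE // !mxE.
Qed.

(** Multiplying by [gamma] turns the hypothesis into the premise of [routing_ge0] for [rho / mu].
    Together with total load 1 this bounds the admissible loads. *)
Lemma load_ge0 (rho : 'cV[R]_nB) :
  (forall b, 0 <= (traffic_mx gamma mu Q *m rho) b 0) -> forall b, 0 <= rho b 0.
Proof.
move=> h b; suff : 0 <= (\col_b (rho b 0 / mu 0 b) : 'cV[R]_nB) b 0.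
  by rewrite mxE pmulr_lge0 // invr_gt0.
apply: routing_ge0 => c; have := h c.
by rewrite traffic_mxE pmulr_lge0 ?invr_gt0 // mulmxBl mul1mx !mxE subr_ge0.
Qed.

Lemma load_exists : (0 < nB)%N ->
  exists rho : 'cV[R]_nB, inner (const_mx 1) rho = 1 /\
    forall b, 0 <= (traffic_mx gamma mu Q *m rho) b 0.
Proof.
(* Normalising [diag(mu) u] to total 1 gives a load whose image under the traffic matrix is
   [1 / (S * gamma)], which is positive. *)
move=> hB; have [u uE] : exists u, (1%:M - Q^T) *m u = const_mx 1 :> 'cV[R]_nB.
  by exists (invmx (1%:M - Q^T) *m const_mx 1); rewrite mulKVmx // routing_unitmx.
have u0 : forall b, 0 <= u b 0.
  apply: routing_ge0 => b; rewrite -subr_ge0.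
  have /(congr1 (fun m : 'cV[R]_nB => m b 0)) := uE.
  by rewrite mulmxBl mul1mx !mxE => ->.
pose S := \sum_b mu 0 b * u b 0.
have Sb b : 0 <= mu 0 b * u b 0 by rewrite mulr_ge0 // ltW.
have S0 : 0 < S.
  rewrite lt_neqAle sumr_ge0 // andbT eq_sym psumr_neq0 //.
  apply/hasP; apply: contrapT => no.
  have uz : u = 0.
    apply/colP => b; rewrite [RHS]mxE; apply/eqP; rewrite eq_le u0 andbT.
    rewrite leNgt; apply/negP => ub; apply: no; exists b; first by rewrite mem_index_enum.
    by rewrite /= mulr_gt0.
  have /(congr1 (fun m : 'cV[R]_nB => m (Ordinal hB) 0)) := uE.
  by rewrite uz mulmx0 !mxE => /eqP; rewrite eq_sym oner_eq0.
exists (\col_b (mu 0 b * u b 0 / S)); split=> [|b].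
  rewrite /inner; under eq_bigr do rewrite !mxE mul1r.
  by rewrite -mulr_suml divff // gt_eqF.
rewrite traffic_mxE (_ : \col_b _ = S^-1 *: u).
  rewrite -scalemxAr uE !mxE mulr1 divr_ge0 ?(ltW (hgamma b)) //.
  by rewrite invr_ge0 ltW.
by apply/colP => c; rewrite !mxE; field; rewrite !gt_eqF.
Qed.
End Traffic.

(** * Equilibrium of the traffic shaping game *)

Lemma continuous_mulfun (R : realType) (T : topologicalType) (f g : T -> R) :
  continuous f -> continuous g -> continuous (fun x => f x * g x).
Proof. by move=> fc gc x; apply: cvgM; [exact: fc | exact: gc]. Qed.

Lemma continuous_addfun (R : realType) (T : topologicalType) (f g : T -> R) :
  continuous f -> continuous g -> continuous (fun x => f x + g x).
Proof. by move=> fc gc x; apply: cvgD; [exact: fc | exact: gc]. Qed.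

Lemma continuous_subfun (R : realType) (T : topologicalType) (f g : T -> R) :
  continuous f -> continuous g -> continuous (fun x => f x - g x).
Proof. by move=> fc gc x; apply: cvgB; [exact: fc | exact: gc]. Qed.

Lemma continuous_maxfun (R : realType) (T : topologicalType) (f g : T -> R) :
  continuous f -> continuous g -> continuous (fun x => Num.max (f x) (g x)).
Proof. by move=> fc gc x; apply: (@continuous_max R _ f); [exact: fc | exact: gc]. Qed.

Lemma continuous_bigmax (R : realType) (T : topologicalType) (J : Type)
    (r : seq J) (f : J -> T -> R) (a : R) :
  (forall j, continuous (f j)) ->
  continuous (fun x => \big[Num.max/a]_(j <- r) f j x).
Proof.
move=> fc; elim: r => [|j r IH].
  rewrite (_ : (fun _ => _) = cst a); first exact: cst_continuous.
  by apply/funext => x; rewrite big_nil.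
rewrite (_ : (fun _ => _) = (fun x => Num.max (f j x) (\big[Num.max/a]_(i <- r) f i x))).
  exact: continuous_maxfun.
by apply/funext => x; rewrite big_cons.
Qed.

Lemma convex_bigmax (R : realType) (J : Type) (r : seq J) (f g h : J -> R) (a : R) :
    0 <= a <= 1 -> (forall j, h j <= a * f j + (1 - a) * g j) ->
  \big[Num.max/0]_(j <- r) h j <=
  a * \big[Num.max/0]_(j <- r) f j + (1 - a) * \big[Num.max/0]_(j <- r) g j.
Proof.
move=> /andP[a0 a1] hfg; elim: r => [|j r IH].
  by rewrite !big_nil !mulr0 addr0.
rewrite !big_cons ge_max; apply/andP; split.
  apply: le_trans (hfg j) _; apply: lerD; apply: ler_wpM2l; rewrite ?subr_ge0 //;
    by rewrite le_max lexx.
apply: le_trans IH _; apply: lerD; apply: ler_wpM2l; rewrite ?subr_ge0 //;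
  by rewrite le_max lexx orbT.
Qed.

Lemma inner_linear (R : realType) nB (c p q : 'cV[R]_nB) a b :
  inner c (a *: p + b *: q) = a * inner c p + b * inner c q.
Proof.
rewrite /inner !mulr_sumr -big_split; apply: eq_bigr => i _ /=.
by rewrite !mxE; ring.
Qed.

Lemma inner_sqr_convex (R : realType) nB (p q : 'cV[R]_nB) a : 0 <= a <= 1 ->
  inner (a *: p + (1 - a) *: q) (a *: p + (1 - a) *: q) <=
  a * inner p p + (1 - a) * inner q q.
Proof.
move=> /andP[a0 a1]; rewrite /inner !mulr_sumr -big_split; apply: ler_sum => i _ /=.
rewrite !mxE -subr_ge0 (_ : _ - _ = a * (1 - a) * (p i 0 - q i 0) ^+ 2); last by ring.
by rewrite mulr_ge0 ?sqr_ge0 // mulr_ge0 // subr_ge0.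
Qed.

Section Equilibrium.
Variables (R : realType) (nB : nat) (V : finType).
Variables (s d : V -> R) (gamma mu : V -> 'rV[R]_nB) (Q : V -> 'M[R]_nB).
Hypotheses (hB : (0 < nB)%N) (hs : forall v, 0 < s v) (hd : forall v, 1 < d v)
  (hgamma : forall v b, 0 < gamma v 0 b) (hmu : forall v b, 0 < mu v 0 b)
  (hQ : forall v, substochastic (Q v)) (hleave : forall v, eventually_leave (Q v)).

Local Notation M v := (traffic_mx (gamma v) (mu v) (Q v)).
Local Notation profile := 'rV[R]_#|{: V * 'I_nB}|.

(* Load profiles are flattened into one row vector, a normed module in which
   Heine-Borel is available. *)
Definition load (x : profile) (v : V) : 'cV[R]_nB := \col_b x 0 (enum_rank (v, b)).

Definition of_loads (l : V -> 'cV[R]_nB) : profile :=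
  \row_k l (enum_val k).1 (enum_val k).2 0.

Lemma of_loadsK l v : load (of_loads l) v = l v.
Proof. by apply/colP => b; rewrite !mxE enum_rankK. Qed.

Lemma load_linear x y a b v : load (a *: x + b *: y) v = a *: load x v + b *: load y v.
Proof. by apply/colP => i; rewrite !mxE. Qed.

Lemma load_continuous v b : continuous (fun x : profile => load x v b 0).
Proof.
rewrite (_ : (fun _ => _) = (fun x : profile => x 0 (enum_rank (v, b)))).
  exact: coord_continuous.
by apply/funext => x; rewrite mxE.
Qed.

Definition admissible v : set 'cV[R]_nB :=
  [set rho | inner (const_mx 1) rho = 1 /\ forall b, 0 <= (M v *m rho) b 0].

Definition admissible_profile : set profile :=
  [set x | forall v, admissible v (load x v)].

(** The coupling [f_v] with the slice's own term split off: that term is a convex quadratic in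
    [rho], the others are linear. *)
Definition congestion v (x : profile) (rho : 'cV[R]_nB) : R :=
  s v * inner rho rho + \sum_(w | w != v) s w * inner (load x w) rho.

(* The least [x_v] for which [(rho, x_v)] is feasible against the loads [x]. *)
Definition least_cost v (x : profile) (rho : 'cV[R]_nB) : R :=
  Num.max (\big[Num.max/0]_b (M v *m rho) b 0)
          (congestion v x rho / (s v * (d v - 1))).

(** The Nikaido-Isoda function of the game, up to sign, on load profiles. *)
Definition regret_gap (x y : profile) : R :=
  \sum_v (least_cost v x (load y v) - least_cost v x (load x v)).

Lemma share_gt0 v : 0 < s v * (d v - 1).
Proof. by rewrite mulr_gt0 // subr_gt0. Qed.

Lemma inner_continuous (T : topologicalType) (f g : T -> 'cV[R]_nB) :
    (forall b, continuous (fun x => f x b 0)) ->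
    (forall b, continuous (fun x => g x b 0)) ->
  continuous (fun x => inner (f x) (g x)).
Proof.
move=> fc gc; apply: (@continuous_bigsum R R^o) => b x.
by apply: cvgM; [exact: fc | exact: gc].
Qed.

Lemma mulmx_continuous (T : topologicalType) (f : T -> 'cV[R]_nB) (A : 'M[R]_nB) b :
    (forall b, continuous (fun x => f x b 0)) ->
  continuous (fun x => (A *m f x) b 0).
Proof.
move=> fc; rewrite (_ : (fun _ => _) = (fun x => \sum_i A b i * f x i 0)).
  apply: (@continuous_bigsum R R^o) => i.
  by apply: continuous_mulfun => //; exact: cst_continuous.
by apply/funext => x; rewrite mxE.
Qed.

(** A general [f] covers both terms of [regret_gap]: the constant load of the deviation and the load
    of [x] itself. *)
Lemma least_cost_continuous (f : profile -> 'cV[R]_nB) v :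
    (forall b, continuous (fun x => f x b 0)) ->
  continuous (fun x => least_cost v x (f x)).
Proof.
move=> fc.
have c1 : continuous (fun x => \big[Num.max/0]_b (M v *m f x) b 0).
  by apply: continuous_bigmax => b; exact: mulmx_continuous.
have c2 : continuous (fun x => congestion v x (f x)).
  rewrite /congestion.
  apply: continuous_addfun.
    by apply: continuous_mulfun; [exact: cst_continuous | exact: inner_continuous].
  under eq_fun do rewrite big_mkcond.
  apply: (@continuous_bigsum R R^o) => w; case: (w != v); last exact: cst_continuous.
  apply: continuous_mulfun; first exact: cst_continuous.
  by apply: inner_continuous => // b; exact: load_continuous.
apply: continuous_maxfun => //.
by apply: continuous_mulfun => //; exact: cst_continuous.
Qed.

Lemma least_cost_convex v x p q a : 0 <= a <= 1 ->
  least_cost v x (a *: p + (1 - a) *: q) <=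
  a * least_cost v x p + (1 - a) * least_cost v x q.
Proof.
move=> a01; have /andP[a0 a1] := a01; have a1' : 0 <= 1 - a by rewrite subr_ge0.
rewrite ge_max; apply/andP; split.
  apply: (@le_trans _ _ (a * \big[Num.max/0]_b (M v *m p) b 0
                     + (1 - a) * \big[Num.max/0]_b (M v *m q) b 0)).
    apply: convex_bigmax => // b.
    by rewrite mulmxDr -!scalemxAr mxE [X in X + _]mxE [X in _ + X]mxE.
  by apply: lerD; apply: ler_wpM2l => //; rewrite le_max lexx.
apply: (@le_trans _ _ (a * (congestion v x p / (s v * (d v - 1)))
                     + (1 - a) * (congestion v x q / (s v * (d v - 1))))).
  rewrite !mulrA -mulrDl ler_pM2r ?invr_gt0 ?share_gt0 //.
  rewrite /congestion !mulrDr addrACA; apply: lerD.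
    rewrite ![_ * (s v * _)]mulrCA -mulrDr ler_pM2l //.
    exact: inner_sqr_convex.
  rewrite !mulr_sumr -big_split; apply: ler_sum => w _ /=.
  by rewrite inner_linear le_eqVlt; apply/orP; left; apply/eqP; ring.
by apply: lerD; apply: ler_wpM2l => //; rewrite le_max lexx orbT.
Qed.

(** The set is closed in the unit cube: loads are nonnegative by [load_ge0] and sum to 1 for each
    slice, so each is at most 1. *)
Lemma admissible_profile_compact : compact admissible_profile.
Proof.
apply: (subclosed_compact _ (@rV_compact R _ _ (fun=> @segment_compact R 0 1))).
  have -> : admissible_profile = \bigcap_(v : V)
      ([set x : profile | inner (const_mx 1) (load x v) = 1] `&`
       \bigcap_(b : 'I_nB) [set x : profile | 0 <= (M v *m load x v) b 0]).
    apply/seteqP; split=> [x xP v _|x xP v].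
      by have [? h] := xP v; split => // b _; exact: h.
    by have [? h] := xP v I; split => // b; exact: h.
  apply: closed_bigI => v _; apply: closedI.
    apply: (@closed_eq_continuous R _
      (fun x : profile => inner (const_mx 1) (load x v)) (cst 1)).
      apply: inner_continuous => b; [exact: cst_continuous | exact: load_continuous].
    exact: cst_continuous.
  apply: closed_bigI => b _.
  apply: (@closed_le_continuous R _ (cst 0) (fun x : profile => (M v *m load x v) b 0)).
    exact: cst_continuous.
  by apply: mulmx_continuous => c; exact: load_continuous.
move=> x xP k /=; rewrite in_itv /=.
case E : (enum_val k) => [v b].
have -> : x ord0 k = load x v b 0 by rewrite mxE -E enum_valK.
have [sum1 /load_ge0 rho0] := xP v; rewrite rho0 //=.
rewrite -sum1 /inner (bigD1 b) //= [X in X * _]mxE mul1r lerDl.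
by apply: sumr_ge0 => c _; rewrite [X in X * _]mxE mul1r rho0.
Qed.

Lemma regret_gap_ge0 :
  exists2 x, admissible_profile x & forall y, admissible_profile y -> 0 <= regret_gap x y.
Proof.
apply: ky_fan.
- move=> x z a xP zP /andP[a0 a1] v; have [x1 x0] := xP v; have [z1 z0] := zP v.
  rewrite load_linear; split; first by rewrite inner_linear x1 z1; ring.
  move=> b; rewrite mulmxDr -!scalemxAr mxE [X in X + _]mxE [X in _ + X]mxE.
  by rewrite addr_ge0 // mulr_ge0 // subr_ge0.
- move=> y _; apply: (@continuous_bigsum R R^o) => v.
  apply: continuous_subfun; apply: least_cost_continuous => b.
    exact: cst_continuous.
  exact: load_continuous.
- move=> x y z a _ _ _ a01; rewrite /regret_gap !mulr_sumr -big_split.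
  apply: ler_sum => v _ /=; rewrite load_linear.
  have := least_cost_convex v x (load y v) (load z v) a01; lra.
- by move=> x _; rewrite /regret_gap big1 // => v _; rewrite subrr.
- exact: admissible_profile_compact.
have [l lP] := choice (fun v => load_exists (hQ v) (hleave v) (hgamma v) (hmu v) hB).
by exists (of_loads l) => v; rewrite of_loadsK.
Qed.

Lemma couplingE (y : V -> strategy R nB) x v (yv : strategy R nB) :
    (forall w, (y w).1 = load x w) ->
  coupling s v (deviate y v yv) = congestion v x yv.1.
Proof.
move=> yx; rewrite /coupling /aggregate_load /congestion.
have innerDl (a b c : 'cV[R]_nB) : inner (a + b) c = inner a c + inner b c.
  by rewrite /inner -big_split; apply: eq_bigr => i _; rewrite mxE mulrDl.
have innerZl k (a c : 'cV[R]_nB) : inner (k *: a) c = k * inner a c.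
  by rewrite /inner mulr_sumr; apply: eq_bigr => i _; rewrite mxE mulrA.
have inner0 (c : 'cV[R]_nB) : inner 0 c = 0.
  by rewrite /inner big1 // => i _; rewrite mxE mul0r.
rewrite (big_morph (fun a : 'cV[R]_nB => inner a _)
  (fun a b => innerDl a b _) (inner0 _)).
rewrite (bigD1 v) //= innerZl /deviate eqxx; congr (_ + _).
by apply: eq_bigr => w /negbTE wv; rewrite innerZl wv yx.
Qed.

(** The constraints involving [x_v] describe the epigraph of [least_cost]. The default 0 of the
    maximum is harmless: by [hB] some station exists, and its constraint gives [0 <= x_v]. *)
Lemma feasibleE (y : V -> strategy R nB) x v (yv : strategy R nB) :
    (forall w, (y w).1 = load x w) ->
  feasible s d gamma mu Q v y yv <-> admissible v yv.1 /\ least_cost v x yv.1 <= yv.2.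
Proof.
move=> yx; rewrite /feasible /= (couplingE _ _ yx) /least_cost ge_max.
rewrite ler_pdivrMr ?share_gt0 // [yv.2 * _]mulrC.
split=> [[r1 rM rc]|[[r1 rM] /andP[rm rc]]].
  split; first by split=> // b; have /andP[] := rM b.
  rewrite rc andbT; apply: bigmax_le; last by move=> b _; have /andP[] := rM b.
  by have /andP[] := rM (Ordinal hB); apply: le_trans.
split=> // b; rewrite rM /=; apply: le_trans rm.
exact: (le_bigmax 0 (fun b => (M v *m yv.1) b 0)).
Qed.

Lemma nash_equilibrium_exists :
  exists y : V -> strategy R nB, nash_equilibrium s d gamma mu Q y.
Proof.
have [x xP gap] := regret_gap_ge0.
pose y v : strategy R nB := (load x v, least_cost v x (load x v)).
have yx w : (y w).1 = load x w by [].
exists y => v; split; first by apply/(feasibleE v (y v) yx); split => //=.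
move=> yv /(feasibleE _ _ yx) [yvP yvc]; rewrite /cost /deviate eqxx.
apply: le_trans yvc => /=.
(* Testing the gap against a profile that differs from [x] only at [v] kills every term of the sum
   except that of [v]. *)
pose l w := if w == v then yv.1 else load x w.
have := gap (of_loads l); rewrite /regret_gap.
rewrite (bigD1 v) //= big1 ?addr0 => [|w /negbTE wv].
  rewrite of_loadsK /l eqxx subr_ge0; apply.
  by move=> w; rewrite of_loadsK /l; case: eqP => [->|_].
by rewrite of_loadsK /l wv subrr.
Qed.
End Equilibrium.

Theorem theorem3 (R : realType) (nB : nat) (V : finType)
  (s d : V -> R) (gamma mu : V -> 'rV[R]_nB) (Q : V -> 'M[R]_nB)
  (hB : (0 < nB)%N) (hV : (0 < #|V|)%N)
  (hs : forall v, 0 < s v) (hs1 : \sum_(v : V) s v = 1)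
  (hd : forall v, 1 < d v)
  (hgamma : forall v b, 0 < gamma v 0 b)
  (hmu : forall v b, 0 < mu v 0 b)
  (hQ : forall v, substochastic (Q v))
  (hleave : forall v, eventually_leave (Q v)) :
  exists y : V -> strategy R nB, nash_equilibrium s d gamma mu Q y.
Proof. exact: nash_equilibrium_exists. Qed.
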